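(* Let $l,t$ be positive integers with $l\geq 2t+3$. There exists a constant $n_0(l,t)$ depending only on $l$ and $t$ such that for all $n\geq n_0(l,t)$ the following holds: if $\mathcal{A}\subseteq P(n,l)$ is non-trivially $t$-intersecting, then \[ \vert \mathcal{A}\vert\leq {n+l-t-1 \choose l-t-1}-{n-1 \choose l-t-1}+t. \] Moreover, equality holds if and only if there is a $t$-subset $T$ of $[l]=\{1,\dots,l\}$ such that \[ \mathcal A=\bigcup_{s\in [l]\setminus T} \mathcal A_s\cup \{ \mathbf q_i : i\in T \}, \] where $\mathcal{A}_s=\{\mathbf u\in P(n,l) : \mathbf u(j)=0 \text{ for all } j\in T \text{ and } \mathbf u(s)=0\}$, and $\mathbf q_i\in P(n,l)$ is given by $\mathbf q_i(j)=0$ for all $j\in [l]\setminus\{i\}$ and $\mathbf q_i(i)=n$.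
   Context: $\mathbb N_0$ is the set of non-negative integers and $P(n,l)=\{(x_1,\dots,x_l)\in\mathbb N_0^l : x_1+\cdots+x_l=n\}$ is the set of weak compositions of $n$ with $l$ parts; for $\mathbf u=(u_1,\dots,u_l)$, $\mathbf u(i)=u_i$. A family $\mathcal A\subseteq P(n,l)$ is $t$-intersecting if $\vert\{i : \mathbf u(i)=\mathbf v(i)\}\vert\geq t$ for all $\mathbf u,\mathbf v\in\mathcal A$. A family $\mathcal A$ is trivially $t$-intersecting if there are a $t$-subset $T\subseteq[l]$ and $y_s\in\mathbb N_0$ ($s\in T$) such that $\mathcal A\subseteq\{\mathbf u\in P(n,l): \mathbf u(j)=y_j \text{ for all } j\in T\}$. A family is non-trivially $t$-intersecting if it is $t$-intersecting but not trivially $t$-intersecting. *)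

(* Defs.v *)
From mathcomp Require Import all_boot.

Set Implicit Arguments.
Unset Strict Implicit.
Unset Printing Implicit Defensive.

(* A part of a weak composition of n is at most n, so functions 'I_l -> nat
   with sum n are represented in the finite type {ffun 'I_l -> 'I_n.+1};
   [weak_comps_complete] below shows that none is lost. The indices 1..l are
   shifted to 0..l-1. *)
Definition weak_comps (n l : nat) : {set {ffun 'I_l -> 'I_n.+1}} :=
  [set u : {ffun 'I_l -> 'I_n.+1} | \sum_(i < l) (u i : nat) == n].

Lemma weak_comps_complete (n l : nat) (f : 'I_l -> nat) :
  \sum_(i < l) f i = n ->
  exists2 u, u \in weak_comps n l & forall i, u i = f i :> nat.
Proof.
move=> sum_f.
have le_f i : f i < n.+1 by rewrite ltnS -sum_f (bigD1 i) //= leq_addr.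
exists [ffun i => Ordinal (le_f i)] => [|i]; last by rewrite ffunE.
by rewrite inE; apply/eqP; rewrite -[RHS]sum_f; apply: eq_bigr => i _; rewrite ffunE.
Qed.

Definition t_intersecting (n l t : nat) (A : {set {ffun 'I_l -> 'I_n.+1}}) : Prop :=
  forall u v, u \in A -> v \in A -> t <= #|[set i | u i == v i]|.

Definition trivially_t_intersecting (n l t : nat)
    (A : {set {ffun 'I_l -> 'I_n.+1}}) : Prop :=
  exists (T : {set 'I_l}) (y : 'I_l -> nat),
    #|T| = t /\
    A \subset [set u in weak_comps n l | [forall j in T, (u j : nat) == y j]].

Definition nontrivially_t_intersecting (n l t : nat)
    (A : {set {ffun 'I_l -> 'I_n.+1}}) : Prop :=
  t_intersecting t A /\ ~ trivially_t_intersecting t A.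

Definition zero_on (n l : nat) (T : {set 'I_l}) (s : 'I_l) :
    {set {ffun 'I_l -> 'I_n.+1}} :=
  [set u in weak_comps n l |
    [forall j in T, (u j : nat) == 0] && ((u s : nat) == 0)].

Definition conc (n l : nat) (i : 'I_l) : {ffun 'I_l -> 'I_n.+1} :=
  [ffun j => if j == i then ord_max else ord0].

(* Main.v *)
Require Import Defs.
From mathcomp Require Import all_boot all_algebra zify.

Set Implicit Arguments.
Unset Strict Implicit.
Unset Printing Implicit Defensive.

Import GRing.Theory.

(* Identify a composition with its graph, a set of [l] pairs (position, value), and
   put d = l - t. Prescribing t + 1 values leaves at most C(n + d - 2, d - 2)
   compositions and prescribing t + 2 values only O(n^(d - 3)). Call a set of t + 1
   pairs heavy if more than l times the latter number of members of the family extend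
   it. A heavy set meets every member, and every other heavy set, in at least t pairs,
   and up to O(n^(d - 3)) members the family is covered by its heavy sets. The extremal
   size is of order d C(n, d - 2), so for large n there are at least d >= t + 3 heavy
   sets; hence they share a kernel T of size t. A member w missing T must contain the
   extra point of every heavy set, so there are exactly d of them, one for each position
   outside T. Therefore every member either extends T and agrees with w somewhere
   outside T, or agrees with w everywhere outside T and misses T in one position; there
   are at most t members of the second kind. Counting those of the first kind amounts to
   showing that among all choices of forbidden values, one per part, forbidding 0
   everywhere leaves the fewest compositions. *)

(** * Heavy sets of an intersecting family *)

Lemma leq_card_bigcup (I X : finType) (P : pred I) (B : I -> {set X}) :
  #|\bigcup_(i | P i) B i| <= \sum_(i | P i) #|B i|.
Proof.
elim/big_rec2: _ => [|i m Y _ leYm]; first by rewrite cards0.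
by rewrite (leq_trans (leq_card_setU _ _).1) // leq_add2l.
Qed.

(** Sets of size t + 1 meeting pairwise in at least t points either share a t-set or lie in one set
    of size t + 2. The latter leaves room for only t + 2 of them. *)
Lemma common_kernel (X : finType) (t : nat) (H : {set {set X}}) :
    {in H, forall K : {set X}, #|K| = t.+1} ->
    {in H &, forall K K' : {set X}, t <= #|K :&: K'|} ->
    t.+2 < #|H| ->
  exists2 T : {set X}, #|T| = t & {in H, forall K : {set X}, T \subset K}.
Proof.
move=> szH intH ltH.
have [K1 K1H] : exists K1, K1 \in H.
  by apply/set0Pn; rewrite -card_gt0; lia.
have [K2 /setD1P[neK K2H]] : exists K2, K2 \in H :\ K1.
  by apply/set0Pn; rewrite -card_gt0; have := cardsD1 K1 H; rewrite K1H; lia.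
have szT : #|K1 :&: K2| = t.
  apply/eqP; rewrite eqn_leq intH // andbT -ltnS -(szH _ K1H).
  apply: proper_card; rewrite properEneq subsetIl andbT.
  apply: contraNneq neK => /setIidPl sK.
  by rewrite eq_sym eqEcard sK !szH /=.
exists (K1 :&: K2) => // K3 K3H; apply: contraLR ltH => nsub; rewrite -leqNgt.
have szU : #|K1 :|: K2| = t.+2 by have := cardsUI K1 K2; rewrite (szH _ K1H) (szH _ K2H) szT; lia.
have szT3 : #|K1 :&: K2 :&: K3| < t.
  rewrite -szT; apply: proper_card; rewrite properEneq subsetIl andbT.
  by apply: contraNneq nsub => /setIidPl.
have sKU (K : {set X}) : K \in H -> K \subset K1 :|: K2 \/ #|K :&: (K1 :|: K2)| <= t.
  move=> KH; case: (boolP (K \subset _)) => [|nK]; first by left.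
  right; rewrite -ltnS -(szH _ KH); apply: proper_card.
  rewrite properEneq subsetIl andbT; by apply: contraNneq nK => /setIidPl.
have eqI (K K' : {set X}) : K \in H -> K' \in H -> K' \subset K1 :|: K2 ->
    #|K :&: (K1 :|: K2)| <= t -> K :&: K' = K :&: (K1 :|: K2).
  move=> KH KH' sK' szK; apply/eqP; rewrite eqEcard setIS //=.
  exact: leq_trans szK (intH _ _ KH KH').
have sK3 : K3 \subset K1 :|: K2.
  case: (sKU _ K3H) => // sz3.
  have e1 := eqI _ _ K3H K1H (subsetUl _ _) sz3.
  have e2 := eqI _ _ K3H K2H (subsetUr _ _) sz3.
  have : K1 :&: K2 :&: K3 = K3 :&: K1.
    by rewrite -[RHS]setIid {2}e1 -e2 -setIIr setIC.
  by move=> e; have := intH _ _ K3H K1H; rewrite -e; lia.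
(* A member K leaving [K1 :|: K2] would have the same intersection with [K1], [K2] and [K3]: at
   least t points common to all three, which have fewer. *)
have sHU : H \subset [set K : {set X} | (K \subset K1 :|: K2) && (#|K| == t.+1)].
  apply/subsetP=> K KH; rewrite inE szH // eqxx andbT.
  case: (sKU _ KH) => // szK.
  have e1 := eqI _ _ KH K1H (subsetUl _ _) szK.
  have e2 := eqI _ _ KH K2H (subsetUr _ _) szK.
  have e3 := eqI _ _ KH K3H sK3 szK.
  have : K :&: K1 \subset K1 :&: K2 :&: K3.
    rewrite !subsetI subsetIr e1 -{1}e2 -e3 !subsetIr //.
  by move/subset_leq_card; have := intH _ _ KH K1H; lia.
by apply: leq_trans (subset_leq_card sHU) _; rewrite cards_draws szU binSn.
Qed.

Section HeavySets.

Variables (X : finType) (l t p1 p2 : nat) (F : {set {set X}}).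

Definition extensions (K : {set X}) := [set S in F | K \subset S].

(** The threshold is the union bound for adjoining to [K] one of at most l points, each choice
    allowing at most [p2] extensions. *)
Definition heavy := [set K : {set X} | (#|K| == t.+1) && (l * p2 < #|extensions K|)].

Hypotheses (lt_tl : t < l) (szF : {in F, forall S : {set X}, #|S| = l})
  (intF : {in F &, forall S S' : {set X}, t <= #|S :&: S'|})
  (nontrivF : forall T : {set X}, #|T| = t -> exists2 S : {set X}, S \in F & ~~ (T \subset S))
  (ext1 : forall K : {set X}, #|K| = t.+1 -> #|extensions K| <= p1)
  (ext2 : forall K : {set X}, #|K| = t.+2 -> #|extensions K| <= p2).

(** If [K] met [Y] in fewer than t points, every extension of [K] would contain a point of [Y]
    outside [K], and there would be too few extensions for [K] to be heavy. *)
Lemma heavy_meets (K Y : {set X}) :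
    K \in heavy -> #|Y| <= l -> {in extensions K, forall S : {set X}, t <= #|S :&: Y|} ->
  t <= #|K :&: Y|.
Proof.
rewrite inE => /andP[/eqP szK hvK] szY meetY; rewrite leqNgt; apply: contraL hvK => ltKY.
rewrite -leqNgt.
have sub : extensions K \subset \bigcup_(x in Y :\: K) extensions (x |: K).
  apply/subsetP=> S SK; have [SF sKS] := setIdP SK.
  have : ~~ (S :&: Y \subset K).
    apply/negP=> sSK; have := meetY _ SK; rewrite leqNgt (leq_ltn_trans _ ltKY) //.
    by apply: subset_leq_card; rewrite subsetI sSK subsetIr.
  case/subsetPn=> x /setIP[xS xY] xK; apply/bigcupP; exists x.
    by rewrite inE xK.
  by rewrite inE SF subUset sub1set xS.
apply: leq_trans (subset_leq_card sub) _; apply: leq_trans (leq_card_bigcup _ _) _.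
have: \sum_(x in Y :\: K) #|extensions (x |: K)| <= \sum_(x in Y :\: K) p2.
  apply: leq_sum => x /setDP[_ xK]; apply: ext2.
  by rewrite cardsU1 xK szK.
move/leq_trans; apply; rewrite sum_nat_const leq_mul2r (leq_trans _ szY) ?orbT //.
by apply: subset_leq_card; rewrite subsetDl.
Qed.

Lemma heavy_cover (K S : {set X}) : K \in heavy -> S \in F -> t <= #|K :&: S|.
Proof.
move=> hK SF; apply: heavy_meets => // [|S' /setIdP[S'F _]]; first by rewrite szF.
exact: intF.
Qed.

(** Second use of [heavy_meets], now with [Y] a heavy set; the first use, [heavy_cover], supplies
    its premise. *)
Lemma heavy_intersecting (K K' : {set X}) :
  K \in heavy -> K' \in heavy -> t <= #|K :&: K'|.
Proof.
move=> hK hK'; apply: heavy_meets => // [|S /setIdP[SF _]].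
  by move: hK'; rewrite inE => /andP[/eqP->].
by rewrite setIC; apply: heavy_cover.
Qed.

(* Every member contains a [t]-subset [K] of a fixed member, and also a point of
   a member chosen to miss [K]. *)
Lemma card_family_heavy : #|F| <= #|heavy| * p1 + 2 ^ l * l * (l * p2).
Proof.
have [->|[S1 S1F]] := set_0Vmem F; first by rewrite cards0.
(* By [nontrivF] the default [set0] is never reached for sets of size t. *)
pose U (K : {set X}) := odflt set0 [pick S in F | ~~ (K \subset S)].
have UP (K : {set X}) : #|K| = t -> U K \in F /\ ~~ (K \subset U K).
  move=> szK; rewrite /U; case: pickP => [S /andP[]//|noS].
  by have [S SF nS] := nontrivF szK; have := noS S; rewrite SF nS.
(* Extensions of heavy sets are already counted in [B], so only light sets contribute to [C]. *)
pose light (K : {set X}) := if K \in heavy then set0 else extensions K.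
pose B := \bigcup_(K in heavy) extensions K.
pose C := \bigcup_(K in [set K in powerset S1 | #|K| == t])
  \bigcup_(x in U K :\: K) light (x |: K).
have sub : F \subset B :|: C.
  apply/subsetP=> S SF.
  have [K sK /eqP szK] : exists2 K : {set X}, K \subset S1 :&: S & #|K| == t.
    have : 0 < #|[set K : {set X} | (K \subset S1 :&: S) && (#|K| == t)]|.
      by rewrite cards_draws bin_gt0 intF.
    by rewrite card_gt0 => /set0Pn[K]; rewrite inE => /andP[]; exists K.
  have [UF nU] := UP _ szK.
  have : ~~ (S :&: U K \subset K).
    apply/negP=> sSK; have := intF SF UF.
    rewrite leqNgt -szK; case/negP; apply: proper_card; rewrite properEneq sSK andbT.
    by apply: contraNneq nU => {1}<-; rewrite subsetIr.
  case/subsetPn=> x /setIP[xS xU] xK.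
  have Sx : S \in extensions (x |: K).
    by rewrite inE SF subUset sub1set xS (subset_trans sK) ?subsetIr.
  rewrite inE; case: (boolP (x |: K \in heavy)) => hx.
    by apply/orP; left; apply/bigcupP; exists (x |: K).
  apply/orP; right; apply/bigcupP; exists K.
    by rewrite !inE szK eqxx andbT (subset_trans sK) ?subsetIl.
  by apply/bigcupP; exists x; rewrite ?inE ?xK // /light (negPf hx).
apply: leq_trans (subset_leq_card sub) _.
apply: leq_trans (leq_card_setU _ _).1 _; apply: leq_add.
  apply: leq_trans (leq_card_bigcup _ _) _; rewrite -sum_nat_const.
  by apply: leq_sum => K; rewrite inE => /andP[/eqP /ext1].
apply: leq_trans (leq_card_bigcup _ _) _.
apply: (@leq_trans (\sum_(K in [set K in powerset S1 | #|K| == t]) l * (l * p2))).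
  apply: leq_sum => K; rewrite inE => /andP[_ /eqP szK].
  have [UF _] := UP _ szK.
  apply: leq_trans (leq_card_bigcup _ _) _.
  apply: (@leq_trans (\sum_(x in U K :\: K) l * p2)).
    apply: leq_sum => x /setDP[_ xK]; rewrite /light; case: ifPn; first by rewrite cards0.
    by rewrite inE cardsU1 xK szK eqxx /= -leqNgt.
  rewrite sum_nat_const leq_mul //.
  by rewrite -(szF UF) subset_leq_card ?subsetDl.
rewrite sum_nat_const -mulnA leq_mul // -(szF S1F) -card_powerset.
by apply: subset_leq_card; apply/subsetP=> K /setIdP[].
Qed.

(** [E] collects the extra points of the heavy sets over their kernel [T]. A member not containing
    [T] must still meet each [x |: T] in t points, so it contains x and all but one point of [T]. *)
Lemma heavy_structure : t.+2 < #|heavy| ->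
  exists T E : {set X},
    [/\ #|T| = t, #|E| = #|heavy|,
        {in E, forall x, x \notin T /\ exists2 S : {set X}, S \in F & x |: T \subset S} &
        {in F, forall S : {set X}, T \subset S \/ #|T :&: S| = t.-1 /\ E \subset S}].
Proof.
move=> lt_heavy.
have szh : {in heavy, forall K : {set X}, #|K| = t.+1} by move=> K; rewrite inE => /andP[/eqP].
have [T szT subT] := common_kernel szh heavy_intersecting lt_heavy.
pose E := [set x | (x \notin T) && (x |: T \in heavy)].
have E1 x : x \in E -> (x \notin T) && (x |: T \in heavy) by rewrite inE.
exists T, E; split=> // [|x|S SF].
- have -> : heavy = (fun x => x |: T) @: E.
    apply/setP=> K; apply/idP/imsetP => [hK|[x /E1/andP[_ hx] ->//]].
    have /cards1P[x def_x] : #|K :\: T| == 1.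
      by rewrite cardsD (setIidPr (subT _ hK)) szh // szT subSnn.
    have def_K : K = x |: T by rewrite -def_x setUC -{1}(setIidPr (subT _ hK)) setID.
    have [_ xT] : x \in K /\ x \notin T.
      by have := set11 x; rewrite -def_x => /setDP.
    by exists x => //; rewrite inE xT -def_K.
  rewrite card_in_imset // => x y /E1/andP[xT _] /E1/andP[yT _] eq_xy.
  have : x \in y |: T by rewrite -eq_xy setU11.
  by rewrite in_setU1 (negPf xT) orbF => /eqP.
- move=> /E1/andP[xT hx]; split=> //.
  have : 0 < #|extensions (x |: T)|.
    by move: hx; rewrite inE => /andP[_]; apply: leq_ltn_trans.
  by rewrite card_gt0 => /set0Pn[S /setIdP[SF sS]]; exists S.
case: (boolP (T \subset S)) => [|nTS]; [by left | right].
have ltTS : #|T :&: S| < t.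
  rewrite -szT; apply: proper_card; rewrite properEneq subsetIl andbT.
  by apply: contraNneq nTS => /setIidPl.
have hE x : x \in E -> x \in S /\ t <= #|T :&: S|.+1.
  move=> /E1/andP[xT hx]; have := heavy_cover hx SF.
  rewrite setIUl; case: (boolP (x \in S)) => xS.
    move=> h; split=> //; apply: leq_trans h _.
    rewrite -add1n (leq_trans (leq_card_setU _ _).1) // leq_add2r.
    by rewrite -(cards1 x) subset_leq_card ?subsetIl.
  have -> : [set x] :&: S = set0 by apply/disjoint_setI0; rewrite disjoints1.
  by rewrite set0U leqNgt ltTS.
split; last by apply/subsetP=> x /hE[].
have [x /hE[_ leT]] : exists x, x \in E.
  have /set0Pn[K hK] : heavy != set0 by rewrite -card_gt0; lia.
  have /set0Pn[x /setDP[xK xT]] : K :\: T != set0.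
    by rewrite -card_gt0 cardsD (setIidPr (subT _ hK)) szh // szT subSnn.
  exists x; rewrite inE xT /=.
  suff -> : x |: T = K by [].
  apply/eqP; rewrite eqEcard subUset sub1set xK subT //= cardsU1 xT szT szh //.
by lia.
Qed.

End HeavySets.

(** * Compositions with forbidden values *)

(* The number of compositions of [m] into [k.+1] positive parts. *)
Definition pos_comps k m := if m is m'.+1 then 'C(m', k) else 0.

Lemma sum_pos_comps k m : \sum_(b < m) pos_comps k b = pos_comps k.+1 m.
Proof.
elim: m => [|m IHm]; first by rewrite big_ord0.
by rewrite big_ord_recr /= IHm; case: m {IHm} => [|m]; rewrite //= binS.
Qed.

Lemma pos_comps_mono k : {homo pos_comps k.+1 : m m' / m <= m'}.
Proof. by move=> [|m] [|m'] //= lemm'; apply: leq_bin2l. Qed.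

Lemma pos_comps_lt k m m' : m < m' -> k.+1 < m' -> pos_comps k.+1 m < pos_comps k.+1 m'.
Proof.
case: m' => // m'; rewrite !ltnS => le_m lt_k.
case: m le_m => [_|m lt_m] /=; first by rewrite bin_gt0.
apply: leq_ltn_trans (leq_bin2l _ (_ : m <= m'.-1)) _; first by lia.
case: m' lt_k {lt_m} => // m' lt_k /=.
by rewrite binS -[X in X < _]addn0 ltn_add2l bin_gt0.
Qed.

Lemma sum_bin_diag k m : \sum_(a < m.+1) 'C(a + k, k) = 'C(m + k.+1, k.+1).
Proof.
elim: m => [|m IHm]; first by rewrite big_ord1 !binn.
by rewrite big_ord_recr /= IHm !addSn [RHS]binS addnS.
Qed.

(** ['C(m + k.+2, k.+2) - pos_comps k.+2 m] counts the compositions of m into k + 3 parts with some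
    part zero; the claim is its strict growth, proved one step at a time by Pascal's rule. *)
Lemma star_comps_lt k m n : m < n ->
  'C(m + k.+2, k.+2) + pos_comps k.+2 n < 'C(n + k.+2, k.+2) + pos_comps k.+2 m.
Proof.
elim: n => // n IHn; rewrite ltnS leq_eqVlt => /predU1P ltmn.
have step : 'C(n + k.+2, k.+2) + pos_comps k.+2 n.+1 <
            'C(n.+1 + k.+2, k.+2) + pos_comps k.+2 n.
  have -> : pos_comps k.+2 n.+1 = pos_comps k.+2 n + pos_comps k.+1 n.
    by rewrite -[LHS]sum_pos_comps big_ord_recr /= sum_pos_comps.
  rewrite addSn [X in _ < X + _]binS.
  suff : pos_comps k.+1 n < 'C(n + k.+2, k.+1) by lia.
  rewrite addnS binS.
  have : 0 < 'C(n + k.+1, k) by rewrite bin_gt0; lia.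
  suff : pos_comps k.+1 n <= 'C(n + k.+1, k.+1) by lia.
  by case: n {IHn ltmn} => //= n; apply: leq_bin2l; lia.
by case: ltmn => [->//|/IHn]; lia.
Qed.

(** Forbidding w deletes the term [g (m - w)], present only if w <= m. The right side is the full
    sum with the term for a = 0 split off, ready to cancel when w = 0. *)
Lemma sum_avoid (g : nat -> nat) m w :
  \sum_(a < m.+1 | a != w :> nat) g (m - a) + (if w <= m then g (m - w) else 0)
    = \sum_(b < m) g b + g m.
Proof.
have -> : \sum_(b < m) g b + g m = \sum_(b < m.+1) g b by rewrite big_ord_recr.
rewrite (reindex_inj rev_ord_inj) /=.
case: leqP => lewm.
  rewrite [RHS](bigID (fun b : 'I_m.+1 => b != m - w :> nat)) /=.
  congr (_ + _).
    apply: eq_big => [a|a _]; last by congr g; have := ltn_ord a; lia.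
    by have := ltn_ord a; lia.
  rewrite (eq_bigl (pred1 (Ordinal (leq_subr w m : m - w < m.+1)))) ?big_pred1_eq //.
  by move=> a; rewrite negbK.
rewrite addn0; apply: eq_big => [a|a _]; last by congr g; have := ltn_ord a; lia.
by lia.
Qed.

Lemma card_setD1_pred (I : finType) (D : {set I}) i : i \in D -> #|D :\ i| = #|D|.-1.
Proof. by move=> iD; rewrite (cardsD1 i D) iD. Qed.

(** * Counting compositions by generating polynomials *)

Section ProductConditions.

Variables (I : finType) (n : nat).
Implicit Types (D T : {set I}) (p : I -> pred nat).

(** Generating polynomial of the compositions indexed by [D] whose part at each i satisfies [p i].
    Parts are capped at n, which is no restriction in degrees m <= n. *)
Definition comps_poly p D : {poly nat} :=
  (\prod_(i in D) \sum_(a < n.+1 | p i a) 'X^a)%R.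

Definition ncomps p D m : nat := ((comps_poly p D)`_m)%R.

Lemma card_comps p m :
  #|[set u : {ffun I -> 'I_n.+1} | (\sum_i (u i : nat) == m) && [forall i, p i (u i)]]|
    = ncomps p setT m.
Proof.
rewrite /ncomps /comps_poly.
have -> : (\prod_(i in [set: I]) \sum_(a < n.+1 | p i a) 'X^a =
    \prod_i \sum_(a < n.+1) ((if p i a then 'X^a else 0) : {poly nat}))%R.
  by apply: eq_big => [i|i _]; rewrite ?inE // big_mkcond.
rewrite bigA_distr_bigA coef_sum -sum1_card big_mkcond /=.
apply: eq_bigr => u _; rewrite inE.
have [/forallP pu|] := boolP [forall i, p i (u i)].
  rewrite (eq_bigr (fun i => 'X^(u i)%R)) => [|i _]; last by rewrite pu.
  by rewrite -expr_sum coefXn eq_sym andbT; case: eqP.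
rewrite negb_forall => /existsP[i npi].
by rewrite andbF (bigD1 i) //= (negPf npi) mul0r coef0.
Qed.

Lemma eq_ncomps p q D m : {in D, forall i, p i =1 q i} -> ncomps p D m = ncomps q D m.
Proof.
move=> eq_pq; rewrite /ncomps; suff -> : comps_poly p D = comps_poly q D by [].
by apply: eq_bigr => i iD; apply: eq_bigl => a; rewrite eq_pq.
Qed.

Lemma ncomps0 p m : ncomps p set0 m = (m == 0).
Proof. by rewrite /ncomps /comps_poly big_set0 coef1; case: m. Qed.

Lemma ncompsD1 p D i m : i \in D -> m <= n ->
  ncomps p D m = \sum_(a < m.+1 | p i a) ncomps p (D :\ i) (m - a).
Proof.
move=> iD lemn; rewrite /ncomps {1}/comps_poly (big_setD1 i) //= coefM.
rewrite [RHS]big_mkcond /=; apply: eq_bigr => a _.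
rewrite coef_sum big_mkcond /=.
have lt_an : a < n.+1 by apply: leq_trans (ltn_ord a) _.
rewrite (bigD1 (Ordinal lt_an)) //= big1 => [|b neq_b].
  by rewrite coefXn eqxx addr0; case: ifP => _; rewrite ?mul1r ?mul0r.
rewrite coefXn; case: eqP => [eq_ab|_]; last by case: ifP.
by case/eqP: neq_b; apply: val_inj.
Qed.

Lemma ncomps_fixed p T (y : I -> nat) m :
    {in T, forall j, p j =1 pred1 (y j)} ->
    \sum_(j in T) y j <= m -> m <= n ->
  ncomps p setT m = ncomps p (~: T) (m - \sum_(j in T) y j).
Proof.
move=> pT le_ym lemn; rewrite /ncomps /comps_poly.
rewrite (big_setID T) setTI setTD /=.
rewrite [X in (X * _)%R](_ : _ = 'X^(\sum_(j in T) y j))%R.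
  by rewrite coefXnM ltnNge le_ym.
rewrite expr_sum; apply: eq_bigr => j jT.
have lt_y : y j < n.+1.
  by rewrite ltnS; apply: leq_trans lemn; apply: leq_trans le_ym; rewrite (bigD1 j) //= leq_addr.
rewrite (eq_bigl (pred1 (Ordinal lt_y))) ?big_pred1_eq // => a.
by rewrite pT.
Qed.

Lemma ncomps_total p D k m : {in D, forall i, p i =1 xpredT} -> #|D| = k.+1 -> m <= n ->
  ncomps p D m = 'C(m + k, k).
Proof.
elim: k D m => [|k IHk] D m pD szD lemn.
  have /cards1P[i def_D] : #|D| == 1 by rewrite szD.
  have iD : i \in D by rewrite def_D set11.
  rewrite (ncompsD1 p iD lemn) (eq_bigl xpredT) => [|a]; last by rewrite pD.
  rewrite bin0 big_ord_recr /= big1 => [|a _]; last first.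
    by rewrite def_D setDv ncomps0 subn_eq0 leqNgt ltn_ord.
  by rewrite def_D setDv ncomps0 subnn.
have [i iD] : exists i, i \in D by apply/set0Pn; rewrite -card_gt0 szD.
rewrite (ncompsD1 p iD lemn) (eq_bigl xpredT) => [|a]; last by rewrite pD.
rewrite -sum_bin_diag (reindex_inj rev_ord_inj) /=; apply: eq_bigr => a _.
rewrite subSS subKn; last by rewrite -ltnS.
apply: IHk; first by move=> j /setD1P[_ /pD].
- by rewrite card_setD1_pred // szD.
- by have := ltn_ord a; lia.
Qed.

Definition avoids (w : I -> nat) : I -> pred nat := fun i a => a != w i.

Lemma ncomps_pos D k m : #|D| = k.+1 -> m <= n ->
  ncomps (avoids (fun=> 0)) D m = pos_comps k m.
Proof.
elim: k D m => [|k IHk] D m szD lemn.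
  have /cards1P[i def_D] : #|D| == 1 by rewrite szD.
  have iD : i \in D by rewrite def_D set11.
  rewrite (ncompsD1 _ iD lemn) def_D setDv.
  under eq_bigr do rewrite ncomps0.
  have := sum_avoid (fun b => b == 0 : nat) m 0; rewrite subn0 /=.
  move/addIn=> ->; case: m {lemn} => [|m] /=; first by rewrite big_ord0.
  by rewrite big_ord_recl big1 // bin0.
have [i iD] : exists i, i \in D by apply/set0Pn; rewrite -card_gt0 szD.
rewrite (ncompsD1 _ iD lemn) -sum_pos_comps.
have := sum_avoid (pos_comps k) m 0; rewrite subn0 /= => /addIn <-.
apply: eq_bigr => a _; apply: IHk; last by lia.
by rewrite card_setD1_pred // szD.
Qed.

Lemma ncomps_avoid1 w i m : m <= n -> ncomps (avoids w) [set i] m = (m != w i).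
Proof.
move=> lemn; rewrite (ncompsD1 _ (set11 i) lemn) setDv.
rewrite big_mkcond big_ord_recr /= big1 => [|a _].
  by rewrite subnn ncomps0 /avoids; case: eqP.
by rewrite ncomps0 subn_eq0 leqNgt ltn_ord; case: ifP.
Qed.

(** Summing over the part at i reduces the comparison with forbidden value 0 to one omitted term
    against [pos_comps k m]: a weak inequality there gives [ncomps_avoid_ge], a strict one
    [ncomps_avoid_gt]. *)
Lemma ncomps_avoid_step w D i k m :
    (forall b, b <= n -> pos_comps k b <= ncomps (avoids w) (D :\ i) b) ->
    i \in D -> m <= n ->
  pos_comps k.+1 m + pos_comps k m <=
    ncomps (avoids w) D m + (if w i <= m then pos_comps k (m - w i) else 0).
Proof.
move=> lb iD lemn; rewrite -sum_pos_comps -(sum_avoid _ m (w i)) leq_add2r.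
rewrite (ncompsD1 _ iD lemn); apply: leq_sum => a _; apply: lb; lia.
Qed.

(* This fails for a single part, so the induction starts at two parts. *)
Lemma ncomps_avoid_ge w D k m : #|D| = k.+2 -> m <= n ->
  pos_comps k.+1 m <= ncomps (avoids w) D m.
Proof.
elim: k D m => [|k IHk] D m szD lemn.
  have [i iD] : exists i, i \in D by apply/set0Pn; rewrite -card_gt0 szD.
  have szDi := card_setD1_pred iD; rewrite szD in szDi.
  have /cards1P[j def_j] : #|D :\ i| == 1 by rewrite szDi.
  rewrite (ncompsD1 _ iD lemn) def_j.
  (* With two parts the value at i determines the other, so at most two of the m + 1 values are
     excluded. *)
  have -> : pos_comps 1 m = m.-1 by case: m {lemn} => [|m] //=; rewrite bin1.
  apply: (@leq_trans (\sum_(a < m.+1 | a != w i :> nat) (m - a != w j))).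
    have /= := sum_avoid (fun b => (b != w j : nat)) m (w i).
    have : m <= \sum_(b < m) (b != w j :> nat) + (m != w j).
      have /= := sum_avoid (fun=> 1) m (w j).
      rewrite big_mkcond sum1_card card_ord big_ord_recr /=.
      have -> : \sum_(b < m) (if b != w j :> nat then 1 else 0) =
                \sum_(b < m) (b != w j :> nat) by apply: eq_bigr => b _; case: eqP.
      by case: (m != w j); case: (w j <= m); lia.
    by case: (w i <= m); case: (m - w i != w j) => /=; lia.
  by apply: eq_leq; apply: eq_bigr => a _; rewrite ncomps_avoid1 //; lia.
have [i iD] : exists i, i \in D by apply/set0Pn; rewrite -card_gt0 szD.
have szDi := card_setD1_pred iD; rewrite szD in szDi.
have := @ncomps_avoid_step w D i k.+1 m (fun b => IHk _ b szDi) iD lemn.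
suff : (if w i <= m then pos_comps k.+1 (m - w i) else 0) <= pos_comps k.+1 m by lia.
by case: ifP => // _; apply: pos_comps_mono; apply: leq_subr.
Qed.

(** Removing i leaves at least two parts, so [ncomps_avoid_ge] applies to them; since [w i] is
    positive, the omitted term is absent or evaluated strictly below m. *)
Lemma ncomps_avoid_gt w D i k m :
    #|D| = k.+3 -> m <= n -> k.+1 < m -> i \in D -> 0 < w i ->
  pos_comps k.+2 m < ncomps (avoids w) D m.
Proof.
move=> szD lemn ltkm iD wi_gt0.
have szDi : #|D :\ i| = k.+2 by rewrite card_setD1_pred // szD.
have := @ncomps_avoid_step w D i k.+1 m (fun b => @ncomps_avoid_ge w _ _ b szDi) iD lemn.
suff : (if w i <= m then pos_comps k.+1 (m - w i) else 0) < pos_comps k.+1 m by lia.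
case: ifP => wm; first by apply: pos_comps_lt => //; lia.
by apply: leq_ltn_trans (leq0n _) (@pos_comps_lt k 0 m _ ltkm); lia.
Qed.

End ProductConditions.

(** * Growth of binomial coefficients *)

Lemma leq_ffact_exp n k : n ^_ k <= n ^ k.
Proof.
elim: k n => [|k IHk] n; first by rewrite ffactn0.
rewrite ffactnS expnS leq_mul2l; apply/orP; right.
by apply: leq_trans (IHk _) _; case: k {IHk} => // k; rewrite leq_exp2r ?leq_pred.
Qed.

Lemma leq_exp_ffact n k : (n - k) ^ k.+1 <= n ^_ k.+1.
Proof.
elim: k n => [|k IHk] n; first by rewrite ffactn1 expn1 subn0.
rewrite ffactnS expnS leq_mul ?leq_subr //.
by apply: leq_trans (IHk _); rewrite -subn1 -subnDA.
Qed.

Lemma bin_eventually_lt (k a M : nat) :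
  exists N0, forall N, N0 <= N -> M * 'C(N + a, k) < 'C(N, k.+1).
Proof.
(* The summands a + 3k give N + a <= 3 (N - k); the remaining ones make N - k exceed the constant
   factor. *)
exists (a + 3 * k + k + (M * 3 ^ k * k.+1`!).+1) => N leN.
rewrite -(ltn_pmul2r (fact_gt0 k.+1)) bin_ffact.
apply: leq_trans (leq_exp_ffact N k).
apply: (@leq_trans ((M * 3 ^ k * k.+1`!).+1 * (N - k) ^ k)); last first.
  by rewrite expnS leq_mul2r; apply/orP; right; lia.
rewrite mulSn -[X in X < _]add0n -addSn leq_add ?expn_gt0 //.
  by apply/orP; left; lia.
have -> : M * 3 ^ k * k.+1`! * (N - k) ^ k = M * (3 * (N - k)) ^ k * k.+1`!.
  by rewrite expnMn; lia.
rewrite leq_mul2r; apply/orP; right; rewrite leq_mul2l; apply/orP; right.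
apply: (@leq_trans ((N + a) ^ k)); last first.
  by case: k leN => // k leN; rewrite leq_exp2r //; lia.
apply: leq_trans (leq_ffact_exp _ _); rewrite -bin_ffact leq_pmulr //.
exact: fact_gt0.
Qed.

Lemma leq_binD N b j : 'C(N, j.+1) + b * 'C(N, j) <= 'C(N + b, j.+1).
Proof.
elim: b => [|b IHb]; first by rewrite mul0n !addn0.
rewrite addnS binS mulSn.
have : 'C(N, j) <= 'C(N + b, j) by apply: leq_bin2l; lia.
by lia.
Qed.

Lemma geq_binD N b j : 'C(N + b, j.+1) <= 'C(N, j.+1) + b * 'C(N + b, j).
Proof.
elim: b => [|b IHb]; first by rewrite addn0 mul0n addn0.
rewrite addnS binS mulSn.
have le_b : 'C(N + b, j) <= 'C((N + b).+1, j) by apply: leq_bin2l; lia.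
have : b * 'C(N + b, j) <= b * 'C((N + b).+1, j) by rewrite leq_mul2l le_b orbT.
by lia.
Qed.

(** With n = N + 1, the right side is at least ['C(N, k.+2) + k.+3 * 'C(N, k.+1)], whose first term
    is [pos_comps k.+2 n]. The left side has only k + 2 copies of ['C(N, k.+1)], up to terms of
    order N^k. *)
Lemma star_dominates (k c : nat) : exists n0, forall n, n0 <= n ->
  k.+2 * 'C(n + k.+1, k.+1) + c * 'C(n + k, k) + pos_comps k.+2 n < 'C(n + k.+2, k.+2).
Proof.
(* [k.+2 * k.+2] is the cost of lowering k + 2 copies of ['C(N + k.+2, k.+1)] to ['C(N, k.+1)]. *)
have [N0 N0P] := bin_eventually_lt k k.+2 (k.+2 * k.+2 + c).
exists N0.+1 => -[//|N]; rewrite ltnS => /N0P ltN /=.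
have := leq_binD N k.+3 k.+1; have := geq_binD N k.+2 k.
rewrite !addSnnS => ub lb.
have : 'C(N + k.+1, k) <= 'C(N + k.+2, k) by apply: leq_bin2l; lia.
move: ltN ub lb.
move: 'C(N + k.+2, k) 'C(N + k.+1, k) 'C(N, k.+1) 'C(N + k.+2, k.+1) => x x' y z.
move: 'C(N, k.+2) 'C(N + k.+3, k.+2) => p q.
by nia.
Qed.

(** * Weak compositions *)

Section WeakCompositions.

Variables (n l : nat).
Implicit Types (u v : {ffun 'I_l -> 'I_n.+1}) (T : {set 'I_l}).

Definition graph u : {set 'I_l * 'I_n.+1} := [set x | u x.1 == x.2].

Lemma graphP u i a : ((i, a) \in graph u) = (u i == a).
Proof. by rewrite inE. Qed.

Lemma graph_inj : injective graph.
Proof. by move=> u v eq_uv; apply/ffunP=> i; apply/eqP; rewrite eq_sym -graphP -eq_uv graphP. Qed.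

Lemma fst_graph_inj u (K : {set 'I_l * 'I_n.+1}) : K \subset graph u -> {in K &, injective fst}.
Proof.
move=> /subsetP sKu [i a] [j b] /sKu ia /sKu jb /= eq_ij.
by move: ia jb; rewrite !graphP -eq_ij => /eqP-> /eqP->.
Qed.

Lemma card_graphI u v : #|graph u :&: graph v| = #|[set i | u i == v i]|.
Proof.
rewrite -(card_in_imset (fst_graph_inj (subsetIl (graph u) (graph v)))).
apply: eq_card => i; rewrite inE; apply/imsetP/idP => [[[j a]]|uv].
  by rewrite inE !graphP => /andP[/eqP uj /eqP vj] /= ->; rewrite uj vj.
by exists (i, u i); rewrite // inE !graphP eqxx eq_sym.
Qed.

Lemma card_graph u : #|graph u| = l.
Proof.
rewrite -[graph u]setIid card_graphI -[RHS]card_ord -cardsT.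
by apply: eq_card => i; rewrite !inE eqxx.
Qed.

Lemma card_weak_comps (p : 'I_l -> pred nat) :
  #|[set u in weak_comps n l | [forall i, p i (u i)]]| = ncomps n p setT n.
Proof. by rewrite -card_comps; apply: eq_card => u; rewrite !inE. Qed.

Lemma card_weak_comps_fixed T (y : 'I_l -> nat) k :
    #|~: T| = k.+1 -> \sum_(j in T) y j <= n ->
  #|[set u in weak_comps n l | [forall j in T, u j == y j :> nat]]|
    = 'C(n - \sum_(j in T) y j + k, k).
Proof.
move=> szT le_yn.
pose p i : pred nat := fun a => (i \in T) ==> (a == y i).
have pT : {in T, forall j, p j =1 pred1 (y j)} by move=> j jT a; rewrite /p jT.
have pnT : {in ~: T, forall j, p j =1 xpredT}.
  by move=> j; rewrite inE => /negPf jT a; rewrite /p jT.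
rewrite -(ncomps_total pnT szT (leq_subr _ n)) -(ncomps_fixed pT) // -card_weak_comps.
by apply: eq_card => u; rewrite !inE.
Qed.

Lemma sum_part_le u T : u \in weak_comps n l -> \sum_(j in T) u j <= n.
Proof.
rewrite inE => /eqP sum_u; rewrite -[X in _ <= X]sum_u big_mkcond /=.
by apply: leq_sum => i _; case: ifP.
Qed.

(** The points of a set inside a graph lie over distinct positions, so [K] leaves r + 1 free parts,
    of sum at most n. *)
Lemma card_extensions_le (K : {set 'I_l * 'I_n.+1}) r : l = #|K| + r.+1 ->
  #|[set u in weak_comps n l | K \subset graph u]| <= 'C(n + r, r).
Proof.
move=> szK; set B := [set u in _ | _].
have [->|[u0]] := set_0Vmem B; first by rewrite cards0.
rewrite inE => /andP[u0n sKu0].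
have szD : #|~: (fst @: K)| = r.+1.
  have := cardsC (fst @: K); rewrite card_ord (card_in_imset (fst_graph_inj sKu0)) //.
  by lia.
apply: (@leq_trans 'C(n - \sum_(j in fst @: K) u0 j + r, r)); last first.
  by apply: leq_bin2l; rewrite leq_add2r leq_subr.
rewrite -card_weak_comps_fixed ?sum_part_le //.
apply: subset_leq_card; apply/subsetP=> u; rewrite !inE => /andP[-> /subsetP sKu] /=.
apply/forall_inP=> _ /imsetP[[j a] jaK ->] /=.
have := sKu _ jaK; have := subsetP sKu0 _ jaK; rewrite !graphP.
by move=> /eqP-> /eqP->.
Qed.

(** For y = w = 0 this is the union of the families [zero_on n T s] over s outside [T]; in general
    [y] and [w] come from two members of the family. *)
Definition star T (y w : 'I_l -> nat) : {set {ffun 'I_l -> 'I_n.+1}} :=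
  [set u in weak_comps n l |
    [forall j in T, u j == y j :> nat] && [exists s in ~: T, u s == w s :> nat]].

Lemma card_star T (y w : 'I_l -> nat) k :
    #|~: T| = k.+1 -> \sum_(j in T) y j <= n ->
  #|star T y w| + ncomps n (avoids w) (~: T) (n - \sum_(j in T) y j)
    = 'C(n - \sum_(j in T) y j + k, k).
Proof.
move=> szT le_yn; rewrite -card_weak_comps_fixed //.
pose B := [set u : {ffun 'I_l -> 'I_n.+1} | [exists s in ~: T, u s == w s :> nat]].
rewrite -[RHS](cardsID B); congr (_ + _).
  by apply: eq_card => u; rewrite !inE andbA.
pose p i : pred nat := fun a => if i \in T then a == y i else a != w i.
have pT : {in T, forall j, p j =1 pred1 (y j)} by move=> j jT a; rewrite /p jT.
rewrite (@eq_ncomps _ _ _ p) => [|j]; last first.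
  by rewrite inE => /negPf jT a; rewrite /p jT.
rewrite -(ncomps_fixed pT) // -card_weak_comps.
apply: eq_card => u; rewrite !inE andbCA; congr (_ && _).
apply/forallP/andP => [pu|[/exists_inPn nB /forall_inP yT] i].
  split.
    apply/exists_inPn=> s; rewrite inE => /negPf sT.
    by have := pu s; rewrite /p sT.
  by apply/forall_inP=> j jT; have := pu j; rewrite /p jT.
by rewrite /p; case: ifPn => iT; [apply: yT | apply: nB; rewrite inE].
Qed.

(** Strictness has two sources: a nonzero y on [T] lowers the sum left for the other parts, where
    [star_comps_lt] applies; otherwise a nonzero w outside [T] is handled by [ncomps_avoid_gt]. *)
Lemma card_star_bound T (y w : 'I_l -> nat) k :
    #|~: T| = k.+3 -> \sum_(j in T) y j <= n -> k.+1 < n ->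
  #|star T y w| + pos_comps k.+2 n <= 'C(n + k.+2, k.+2) ?= iff
    [forall j in T, y j == 0] && [forall s in ~: T, w s == 0].
Proof.
move=> szT le_yn ltkn; have := card_star w szT le_yn.
set m := n - _ => card_m.
have lemn : m <= n by apply: leq_subr.
have ge_av := ncomps_avoid_ge w szT lemn.
have [/forall_inP y0|y_n0] /= := boolP [forall j in T, y j == 0]; last first.
  have ltmn : m < n.
    rewrite negb_forall_in in y_n0; case/exists_inP: y_n0 => j jT yj.
    have : 0 < \sum_(j in T) y j by rewrite (bigD1 j) //=; lia.
    by rewrite /m; lia.
  have lt_star := star_comps_lt k ltmn.
  apply/leqifP => /=; rewrite -(ltn_add2r (pos_comps k.+2 m)) addnAC.
  apply: leq_ltn_trans lt_star; rewrite leq_add2r -card_m leq_add2l.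
  exact: ge_av.
have def_m : m = n by rewrite /m big1 ?subn0 // => j /y0/eqP.
rewrite def_m in card_m ge_av.
have [/forall_inP w0|w_n0] := boolP [forall s in ~: T, w s == 0].
  apply/leqifP/eqP; rewrite -card_m; congr (_ + _).
  rewrite (@eq_ncomps _ _ _ (avoids (fun=> 0))) ?(ncomps_pos szT) //.
  by move=> s /w0/eqP w0s a; rewrite /avoids w0s.
rewrite negb_forall_in in w_n0; case/exists_inP: w_n0 => s sT ws.
have := ncomps_avoid_gt szT (leqnn n) ltkn sT (_ : 0 < w s).
rewrite lt0n ws => /(_ isT) gt_av.
by apply/leqifP => /=; rewrite -card_m ltn_add2l.
Qed.

Lemma conc_weak_comps i : conc n i \in weak_comps n l.
Proof.
rewrite inE (bigD1 i) //= ffunE eqxx big1 ?addn0 // => j /negPf ji.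
by rewrite ffunE ji.
Qed.

Lemma weak_comps_eq u v i : u \in weak_comps n l -> v \in weak_comps n l ->
  (forall j, j != i -> u j = v j) -> u = v.
Proof.
rewrite !inE => /eqP su /eqP sv eq_uv; apply/ffunP=> j.
have [->|/eq_uv//] := eqVneq j i; apply: val_inj => /=.
have := etrans su (esym sv); rewrite (bigD1 i) //= [RHS](bigD1 i) //=.
by rewrite (eq_bigr (fun j => v j : nat)) => [/addIn|j' /eq_uv->].
Qed.

Lemma bigcup_zero_on T :
  \bigcup_(s in ~: T) zero_on n T s = star T (fun=> 0) (fun=> 0).
Proof.
apply/setP=> u; apply/bigcupP/idP => [[s sT]|].
  rewrite !inE => /and3P[-> -> us] /=; apply/exists_inP; by exists s.
rewrite inE => /and3P[un uT /exists_inP[s sT us]].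
by exists s => //; rewrite inE un uT.
Qed.

(** The star vanishes on [T], whereas [conc n i] takes the positive value n at i, so the union is
    disjoint; the size of the star is the equality case of [card_star_bound]. *)
Lemma card_extremal T t k : #|T| = t -> #|~: T| = k.+3 -> k.+1 < n ->
  #|(\bigcup_(s in ~: T) zero_on n T s) :|: [set conc n i | i in T]|
    = 'C(n + k.+2, k.+2) - pos_comps k.+2 n + t.
Proof.
move=> szT szTC ltkn; have n_gt0 : 0 < n by lia.
rewrite bigcup_zero_on.
set C := [set conc n i | i in T].
have /eqP -> : #|star T (fun=> 0) (fun=> 0) :|: C| == #|star T (fun=> 0) (fun=> 0)| + #|C|.
  rewrite (leq_card_setU _ _).2 disjoint_sym disjoint_subset.
  apply/subsetP=> _ /imsetP[i iT ->]; rewrite !inE; apply/negP.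
  move=> /and3P[_ /forall_inP/(_ i iT) ci _].
  by move: ci; rewrite ffunE eqxx /=; lia.
have -> : #|star T (fun=> 0) (fun=> 0)| = 'C(n + k.+2, k.+2) - pos_comps k.+2 n.
  have [|_ eq_star] := @card_star_bound T (fun=> 0) (fun=> 0) k szTC _ ltkn.
    by rewrite big1.
  suff /eqP <- : #|star T (fun=> 0) (fun=> 0)| + pos_comps k.+2 n == 'C(n + k.+2, k.+2).
    by rewrite addnK.
  by rewrite eq_star; apply/andP; split; apply/forall_inP.
rewrite -szT; congr (_ + _); rewrite card_imset // => i j /ffunP/(_ i).
rewrite !ffunE eqxx; case: eqP => // _ /(congr1 val) /= n0.
by rewrite n0 in n_gt0.
Qed.

(* At most one composition for each [i] in [T]: the value at [i] is forced by the sum. *)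
Definition near_misses T (y w : {ffun 'I_l -> 'I_n.+1}) i :=
  [set u in weak_comps n l |
    [forall j, (j != i) ==> (u j == (if j \in T then y j else w j))]].

Lemma card_near_misses T (y w : {ffun 'I_l -> 'I_n.+1}) :
  #|\bigcup_(i in T) near_misses T y w i| <= #|T|.
Proof.
apply: leq_trans (leq_card_bigcup _ _) _; rewrite -sum1_card; apply: leq_sum => i _.
apply/card_le1_eqP=> u v /setIdP[un /forallP pu] /setIdP[vn /forallP pv].
apply: (@weak_comps_eq _ _ i) => // j ji.
by have := pu j; have := pv j; rewrite ji /= => /eqP-> /eqP->.
Qed.

End WeakCompositions.

(** * Structure of large non-trivial families *)

Section NonTrivialFamilies.

Variables (n l t k : nat) (A : {set {ffun 'I_l -> 'I_n.+1}}).
Hypotheses (def_l : l = t + k.+3) (sAn : A \subset weak_comps n l)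
  (ntA : nontrivially_t_intersecting t A).

Let F := [set graph u | u in A].

Lemma card_graphs : #|F| = #|A|.
Proof. by rewrite card_imset //; apply: graph_inj. Qed.

Lemma uniform_graphs : {in F, forall S : {set 'I_l * 'I_n.+1}, #|S| = l}.
Proof. by move=> _ /imsetP[u _ ->]; apply: card_graph. Qed.

Lemma intersecting_graphs : {in F &, forall S S' : {set 'I_l * 'I_n.+1}, t <= #|S :&: S'|}.
Proof.
move=> _ _ /imsetP[u uA ->] /imsetP[v vA ->]; rewrite card_graphI.
by case: ntA => intA _; apply: intA.
Qed.

(** A t-set inside all graphs would fix values at t distinct positions and make [A] trivial. An
    empty [A] has no graph to read positions from, but is trivial for any t positions. *)
Lemma nontrivial_graphs (T : {set 'I_l * 'I_n.+1}) : #|T| = t ->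
  exists2 S, S \in F & ~~ (T \subset S).
Proof.
move=> szT; apply/exists_inP; apply: contraT; rewrite negb_exists_in => /forall_inP sT.
case: ntA => _ []; have [A0|[u0 u0A]] := set_0Vmem A.
  have : 0 < #|[set D : {set 'I_l} | #|D| == t]|.
    by rewrite card_draws card_ord bin_gt0; lia.
  rewrite card_gt0 => /set0Pn[D]; rewrite inE => /eqP szD.
  by exists D, (fun=> 0); rewrite A0 sub0set.
have sTA u : u \in A -> T \subset graph u.
  by move=> uA; have := sT _ (imset_f (@graph n l) uA); rewrite negbK.
exists (fst @: T), (fun j => u0 j : nat).
rewrite (card_in_imset (fst_graph_inj (sTA _ u0A))); split=> //.
apply/subsetP=> u uA; rewrite inE (subsetP sAn) //=.
apply/forall_inP=> _ /imsetP[[j a] jaT ->] /=.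
have := subsetP (sTA _ uA) _ jaT; have := subsetP (sTA _ u0A) _ jaT.
by rewrite !graphP => /eqP-> /eqP->.
Qed.

Lemma card_graph_extensions (K : {set 'I_l * 'I_n.+1}) r : l = #|K| + r.+1 ->
  #|extensions F K| <= 'C(n + r, r).
Proof.
move=> szK; apply: leq_trans (card_extensions_le szK).
rewrite -(card_imset _ (@graph_inj n l)); apply: subset_leq_card.
apply/subsetP=> _ /setIdP[/imsetP[u uA ->] sKu].
by apply: imset_f; rewrite inE (subsetP sAn).
Qed.

Let p1 := 'C(n + k.+1, k.+1).
Let p2 := 'C(n + k, k).

Lemma card_extensions_t1 (K : {set 'I_l * 'I_n.+1}) : #|K| = t.+1 -> #|extensions F K| <= p1.
Proof. by move=> szK; apply: card_graph_extensions; rewrite szK; lia. Qed.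

Lemma card_extensions_t2 (K : {set 'I_l * 'I_n.+1}) : #|K| = t.+2 -> #|extensions F K| <= p2.
Proof. by move=> szK; apply: card_graph_extensions; rewrite szK; lia. Qed.

(** By [card_family_heavy], k + 2 heavy sets cannot account for [A], so there are at least k + 3 = l
    - t, more than t + 2. Then [y] is a member containing the kernel [T0] and [w] one missing it. *)
Lemma large_family_structure : t <= k -> 0 < t -> k.+2 * p1 + 2 ^ l * l * (l * p2) < #|A| ->
  exists (T : {set 'I_l}) (y w : {ffun 'I_l -> 'I_n.+1}), [/\ #|T| = t, y \in A &
    A \subset star n T (fun i => y i) (fun i => w i)
              :|: \bigcup_(i in T) near_misses T y w i].
Proof.
move=> le_tk t_gt0 ltA; have lt_tl : t < l by lia.
have lt_heavy : k.+2 < #|heavy l t p2 F|.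
  rewrite ltnNge; apply: contraL ltA => le_heavy; rewrite -leqNgt -card_graphs.
  apply: leq_trans (card_family_heavy p2 uniform_graphs intersecting_graphs
    nontrivial_graphs card_extensions_t1) _.
  by rewrite leq_add2r leq_mul2r le_heavy orbT.
have [|T0 [E [szT0 szE EP FP]]] := heavy_structure lt_tl uniform_graphs
  intersecting_graphs card_extensions_t2.
  by apply: leq_ltn_trans lt_heavy; lia.
have [e0 e0E] : exists e, e \in E by apply/set0Pn; rewrite -card_gt0 szE; lia.
have [_ [_ /imsetP[y yA ->] sT0y]] := EP _ e0E.
have {sT0y} sT0y : T0 \subset graph y by apply: subset_trans sT0y; apply: subsetUr.
have [_ /imsetP[w wA ->] nT0w] := nontrivial_graphs szT0.
have sEw : E \subset graph w by case: (FP _ (imset_f (@graph n l) wA)) nT0w => [->|[]].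
pose T := [set x.1 | x in T0]; exists T, y, w.
have szT : #|T| = t by rewrite (card_in_imset (fst_graph_inj sT0y)).
have defT0 j : j \in T -> (j, y j) \in T0.
  case/imsetP=> -[j' a] jaT /= ->.
  by have := subsetP sT0y _ jaT; rewrite graphP => /eqP->.
(* A point of [E] over [T] would share a graph with the point of [T0] at that position, hence equal
   it, though [E] avoids [T0]. So [E] lies over the k + 3 positions outside [T], and its size fills
   them. *)
have defE : [set x.1 | x in E] = ~: T.
  apply/eqP; rewrite eqEcard; apply/andP; split.
    apply/subsetP=> _ /imsetP[[s a] saE ->] /=; rewrite inE.
    have [saT [_ /imsetP[u uA ->] /subsetP su]] := EP _ saE.
    apply: contra saT => /defT0 syT; have := su _ (setU11 _ _).
    by have := su _ (setU1r _ syT); rewrite !graphP => /eqP-> /eqP<-.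
  rewrite (card_in_imset (fst_graph_inj sEw)) szE.
  by have := cardsC T; rewrite card_ord szT; lia.
have inE' s : s \notin T -> (s, w s) \in E.
  rewrite -in_setC -defE => /imsetP[[s' a] saE /= ->].
  by have := subsetP sEw _ saE; rewrite graphP => /eqP->.
have meetT u : #|T0 :&: graph u| = #|[set j in T | u j == y j]|.
  rewrite -(card_in_imset (fst_graph_inj (subset_trans (subsetIl _ (graph u)) sT0y))).
  apply: eq_card => j; rewrite inE; apply/imsetP/andP => [[[j' a]]|[jT uj]].
    rewrite inE graphP => /andP[jaT uj] /= ->; split; first by apply: (imset_f fst jaT).
    by have := subsetP sT0y _ jaT; rewrite graphP => /eqP->.
  by exists (j, y j); rewrite // inE defT0 // graphP.
split=> //; apply/subsetP=> u uA; rewrite inE; apply/orP.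
have un := subsetP sAn _ uA.
case: (FP _ (imset_f (@graph n l) uA)) => [sT0u|[szTu sEu]]; [left | right].
  have uT j : j \in T -> u j = y j.
    by move/defT0/(subsetP sT0u); rewrite graphP => /eqP.
  rewrite inE un /=; apply/andP; split; first by apply/forall_inP=> j /uT->.
  (* Otherwise u and w agree only inside [T], at fewer than t positions because w misses [T0]. *)
  apply: contraT; rewrite negb_exists_in => /forall_inP nT.
  have [intA _] := ntA; have := intA _ _ uA wA; rewrite leqNgt => /negP[].
  have -> : [set i | u i == w i] = [set j in T | w j == y j].
    apply/setP=> i; rewrite !inE; have [/uT->|iT] := boolP (i \in T).
      by rewrite eq_sym.
    by have := nT i; rewrite inE iT => /(_ isT)/negPf.
  rewrite -meetT -szT0; apply: proper_card; rewrite properEneq subsetIl andbT.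
  by apply: contraNneq nT0w => /setIidPl.
(* Agreement at exactly t - 1 positions of [T] leaves a single exception. *)
have [i def_i] : exists i, T :\: [set j in T | u j == y j] = [set i].
  apply/cards1P; rewrite cardsD (setIidPr _) -?meetT ?szTu ?szT; first by apply/eqP; lia.
  by apply/subsetP=> j /setIdP[].
have : i \in T :\: [set j in T | u j == y j] by rewrite def_i set11.
rewrite inE => /andP[_ iT]; apply/bigcupP; exists i => //.
rewrite inE un /=; apply/forallP=> j; apply/implyP=> ji; case: ifPn => jT.
  have : j \notin T :\: [set j in T | u j == y j] by rewrite def_i inE.
  by rewrite !inE jT andbT negbK.
by have := subsetP sEu _ (inE' _ jT); rewrite graphP.
Qed.

End NonTrivialFamilies.

(** * The bound and the case of equality *)

Theorem theorem1p3 (l t : nat) (l_gt0 : 0 < l) (t_gt0 : 0 < t)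
    (le_l : 2 * t + 3 <= l) :
  exists n0 : nat, forall n : nat, n0 <= n ->
  forall A : {set {ffun 'I_l -> 'I_n.+1}},
    A \subset weak_comps n l ->
    nontrivially_t_intersecting t A ->
    #|A| <= 'C(n + l - t - 1, l - t - 1) - 'C(n - 1, l - t - 1) + t
    /\ (#|A| = 'C(n + l - t - 1, l - t - 1) - 'C(n - 1, l - t - 1) + t <->
        exists T : {set 'I_l},
          #|T| = t /\
          A = (\bigcup_(s in ~: T) zero_on n T s) :|: [set conc n i | i in T]).
Proof.
have [k def_l] : exists k, l = t + k.+3 by exists (l - t - 3); lia.
(* [2 ^ l * l * l] is the coefficient of ['C(n + k, k)] in the light part of [card_family_heavy]. *)
have [n0 n0P] := star_dominates k (2 ^ l * l * l).
(* The summand k + 2 secures k + 1 < n for [card_star_bound]. *)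
exists (n0 + k.+2) => n le_n A sAn ntA.
have le_n0 : n0 <= n by lia.
have ltkn : k.+1 < n by lia.
have {n0P le_n0} ltstar := n0P _ le_n0.
have -> : l - t - 1 = k.+2 by lia.
have -> : n + l - t - 1 = n + k.+2 by lia.
have -> : 'C(n - 1, k.+2) = pos_comps k.+2 n.
  by rewrite subn1; case: (n) ltkn.
have szTC (T : {set 'I_l}) : #|T| = t -> #|~: T| = k.+3.
  by move=> szT; have := cardsC T; rewrite card_ord szT; lia.
suff [leA extA] : #|A| <= 'C(n + k.+2, k.+2) - pos_comps k.+2 n + t /\
    (#|A| = 'C(n + k.+2, k.+2) - pos_comps k.+2 n + t -> exists T : {set 'I_l},
      #|T| = t /\ A = (\bigcup_(s in ~: T) zero_on n T s) :|: [set conc n i | i in T]).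
  split=> //; split=> // -[T [szT ->]].
  by rewrite (@card_extremal _ _ T t k) ?szTC.
have [small|large] := leqP #|A| (k.+2 * 'C(n + k.+1, k.+1) + 2 ^ l * l * (l * 'C(n + k, k))).
  rewrite mulnA in small.
  suff : #|A| < 'C(n + k.+2, k.+2) - pos_comps k.+2 n + t by lia.
  apply: leq_trans (leq_addr t _); rewrite ltn_subRL addnC.
  by apply: leq_ltn_trans ltstar; rewrite leq_add2r.
(* The assumption l >= 2t + 3 enters here as t <= k. *)
have [|T [y [w [szT yA sA]]]] := large_family_structure def_l sAn ntA _ t_gt0 large.
  by lia.
have le_yn : \sum_(j in T) y j <= n by apply/sum_part_le/(subsetP sAn).
have [le_star eq_star] := card_star_bound (fun i => w i) (szTC _ szT) le_yn ltkn.
have le_near := card_near_misses T y w; rewrite szT in le_near.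
have leA : #|A| <= #|star n T (fun i => y i) (fun i => w i)| + t.
  apply: leq_trans (subset_leq_card sA) _; apply: leq_trans (leq_card_setU _ _).1 _.
  by rewrite leq_add2l.
have le_star' : #|star n T (fun i => y i) (fun i => w i)| <=
    'C(n + k.+2, k.+2) - pos_comps k.+2 n.
  by rewrite leq_subRL ?(leq_trans _ le_star) ?leq_addl // addnC.
split; first by apply: leq_trans leA _; rewrite leq_add2r.
move=> eqA; exists T; split=> //.
(* Beyond the star there are at most t near misses, so attaining the bound forces a star of maximal
   size, hence y = 0 on [T] and w = 0 outside. *)
have : #|star n T (fun i => y i) (fun i => w i)| + pos_comps k.+2 n == 'C(n + k.+2, k.+2).
  move: leA; rewrite eqA leq_add2r => ge_star.
  by rewrite eqn_leq le_star /= [X in _ <= X]addnC -leq_subLR.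
rewrite eq_star => /andP[/forall_inP y0 /forall_inP w0].
apply/eqP; rewrite eqEcard (@card_extremal _ _ T t k) ?szTC //.
rewrite eqA leqnn andbT; apply: subset_trans sA _; rewrite bigcup_zero_on.
apply: setUSS.
  apply/subsetP=> u; rewrite !inE => /and3P[-> /forall_inP uT /exists_inP[s sT us]] /=.
  apply/andP; split; first by apply/forall_inP=> j jT; rewrite (eqP (uT j jT)) y0.
  by apply/exists_inP; exists s => //; rewrite (eqP us) w0.
(* A near miss at i now vanishes off i, so having sum n makes it [conc n i]. *)
apply/bigcupsP=> i iT; apply/subsetP=> u /setIdP[un /forallP pu].
apply/imsetP; exists i => //.
apply: (@weak_comps_eq _ _ _ _ i) => // [|j ji]; first exact: conc_weak_comps.
have := pu j; rewrite ji ffunE (negPf ji) /= => /eqP->; apply: val_inj => /=.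
by case: ifPn => jT; [apply/eqP/y0 | apply/eqP/w0; rewrite inE].
Qed.
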